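(* Throughout, $\beta_1\ge\beta_2>0$, $\tau_1,\tau_2>0$, $\lambda>0$; Turing instability, unimodular Turing instability and the quantities $\alpha_1,\alpha_2$ (depending on $\beta_1,\beta_2,\lambda$) are as defined in the context. (i) If Turing instability occurs for the parameters $(\beta_1,\beta_2,\tau_1,\tau_2,\lambda)$, then one of the following two situations holds: either $\alpha_2<1<\alpha_1$ and $\tau_1<\tau_2$; or $\alpha_1<1<\alpha_2$ and $\tau_2<\tau_1$. (ii) If $\beta_1>1$, $\beta_2<1$ and $\beta_1+\beta_2<2$, then there exist $\lambda>0$, $\tau_1>0$, $\tau_2>0$ such that Turing instability occurs for $(\beta_1,\beta_2,\tau_1,\tau_2,\lambda)$. (iii) There exists $\delta\in(0,1)$ such that, whenever $\beta_1>1$, $1-\delta<\beta_2<1$ and $\beta_1+\beta_2<2$, there exist $\lambda>0$, $\tau_1>0$, $\tau_2>0$ such that unimodular Turing instability occurs for $(\beta_1,\beta_2,\tau_1,\tau_2,\lambda)$.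
   Context: Let $\mathbb T=[0,1)$ be the unit torus. For $i\in\{1,2\}$ let $\phi_i(r,\tilde r)=\sum_{a\in\mathbb Z}\frac{1}{\sqrt{2\pi\tau_i}}e^{-(r-\tilde r-a)^2/(2\tau_i)}$ be the periodized Gaussian kernel with variance $\tau_i$; its Fourier coefficients are $\hat\phi_i^{(k)}=\int_0^1\phi_i(0,r)e^{-2\pi \mathtt i kr}dr=e^{-2\pi^2\tau_i k^2}$, $k\in\mathbb Z$. The hydrodynamic equations are $$\partial_t u_1=-u_1+\tfrac12[\tanh(\beta_1u_1*\phi_1+\beta_1\lambda)+\tanh(\beta_1u_1*\phi_1-\beta_1\lambda)]+\tfrac{u_2}{2}[\tanh(\beta_1u_1*\phi_1+\beta_1\lambda)-\tanh(\beta_1u_1*\phi_1-\beta_1\lambda)],$$ $$\partial_t u_2=-u_2+\tfrac12[\tanh(\beta_2u_2*\phi_2+\beta_2\lambda)+\tanh(\beta_2u_2*\phi_2-\beta_2\lambda)]-\tfrac{u_1}{2}[\tanh(\beta_2u_2*\phi_2+\beta_2\lambda)-\tanh(\beta_2u_2*\phi_2-\beta_2\lambda)].$$ Linearizing them around the null solution and taking the $k$-th Fourier coefficient gives the linear system $\frac{d}{dt}\hat u^{(k)}=A^{(k)}\hat u^{(k)}$ with $$A^{(k)}=\begin{pmatrix}-1+\alpha_1\hat\phi_1^{(k)}&\tanh(\beta_1\lambda)\\-\tanh(\beta_2\lambda)&-1+\alpha_2\hat\phi_2^{(k)}\end{pmatrix},\qquad \alpha_i=\frac{\beta_i}{[\cosh(\lambda\beta_i)]^2}.$$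 Let $\mu_1^{(k)},\mu_2^{(k)}$ be the two (complex) eigenvalues of $A^{(k)}$. The $k$-th Fourier mode is called linearly stable if $\max\{\mathrm{Re}\,\mu_1^{(k)},\mathrm{Re}\,\mu_2^{(k)}\}<0$ and linearly unstable if $\max\{\mathrm{Re}\,\mu_1^{(k)},\mathrm{Re}\,\mu_2^{(k)}\}>0$. Turing instability occurs if the mode $k=0$ is linearly stable and some mode $k\in\mathbb Z\setminus\{0\}$ is linearly unstable. Unimodular Turing instability occurs if the modes $k=\pm1$ are linearly unstable and all modes $k\in\mathbb Z$, $k\ne\pm1$, are linearly stable. *)

(* Defs.v *)
From mathcomp Require Import all_boot all_order all_algebra.
From mathcomp Require Import all_classical all_reals all_analysis.
From mathcomp Require Import complex.

Set Implicit Arguments.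
Unset Strict Implicit.
Unset Printing Implicit Defensive.

Import Order.TTheory GRing.Theory Num.Theory.
Import numFieldNormedType.Exports.

Local Open Scope classical_set_scope.
Local Open Scope complex_scope.
Local Open Scope ring_scope.

Section Eigenvalues.
Context {F : closedFieldType} {n : nat}.

(* Listed with multiplicity, in an unspecified order. *)
Definition eigenvalues (A : 'M[F]_n) : seq F :=
  sval (closed_field_poly_normal (char_poly A)).

Lemma char_poly_eigenvalues (A : 'M[F]_n) :
  char_poly A = \prod_(z <- eigenvalues A) ('X - z%:P).
Proof.
rewrite /eigenvalues; case: closed_field_poly_normal => /= r.
by rewrite (monicP (char_poly_monic A)) scale1r.
Qed.

Lemma size_eigenvalues (A : 'M[F]_n) : size (eigenvalues A) = n.
Proof.
have := size_char_poly A.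
by rewrite char_poly_eigenvalues size_prod_XsubC => -[].
Qed.

End Eigenvalues.

Section Model.
Context {R : realType}.
Implicit Types (beta tau lam x : R) (k : int).

Definition cosh x : R := (expR x + expR (- x)) / 2.
Definition sinh x : R := (expR x - expR (- x)) / 2.
Definition tanh x : R := sinh x / cosh x.

(* The sum over the integers is taken in the extended reals, where a sum of
   nonnegative terms always exists; for tau > 0 it is finite. *)
Definition periodized_gaussian tau (r r' : R) : R :=
  fine (\esum_(a in [set: int])
    ((Num.sqrt (2 * pi * tau))^-1 *
     expR (- (r - r' - a%:~R) ^+ 2 / (2 * tau)))%:E).

(* The integral over [0, 1] of phi(0, r) exp(- 2 pi i k r), written through
   exp(- i t) = cos t - i sin t. *)
Definition kernel_fourier tau k : R[i] :=
  (\int[lebesgue_measure]_(r in `[0%R, 1%R])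
     (periodized_gaussian tau 0 r * cos (2 * pi * k%:~R * r)))
  -i*
  (\int[lebesgue_measure]_(r in `[0%R, 1%R])
     (periodized_gaussian tau 0 r * sin (2 * pi * k%:~R * r))).

Definition alpha beta lam : R := beta / cosh (lam * beta) ^+ 2.

Definition mode_matrix (beta1 beta2 tau1 tau2 lam : R) k : 'M[R[i]]_2 :=
  \matrix_(i < 2, j < 2)
    if i == 0 then
      if j == 0 then -1 + (alpha beta1 lam)%:C * kernel_fourier tau1 k
      else (tanh (beta1 * lam))%:C
    else
      if j == 0 then (- tanh (beta2 * lam))%:C
      else -1 + (alpha beta2 lam)%:C * kernel_fourier tau2 k.

Definition max_growth_rate (beta1 beta2 tau1 tau2 lam : R) k : R :=
  let mu := eigenvalues (mode_matrix beta1 beta2 tau1 tau2 lam k) in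
  Num.max (complex.Re mu`_0) (complex.Re mu`_1).

Definition linearly_stable (beta1 beta2 tau1 tau2 lam : R) k : Prop :=
  max_growth_rate beta1 beta2 tau1 tau2 lam k < 0.

Definition linearly_unstable (beta1 beta2 tau1 tau2 lam : R) k : Prop :=
  0 < max_growth_rate beta1 beta2 tau1 tau2 lam k.

Definition Turing_instability (beta1 beta2 tau1 tau2 lam : R) : Prop :=
  linearly_stable beta1 beta2 tau1 tau2 lam 0 /\
  exists2 k : int, k != 0 & linearly_unstable beta1 beta2 tau1 tau2 lam k.

Definition unimodular_Turing_instability
    (beta1 beta2 tau1 tau2 lam : R) : Prop :=
  [/\ linearly_unstable beta1 beta2 tau1 tau2 lam 1,
      linearly_unstable beta1 beta2 tau1 tau2 lam (-1) &
      forall k : int, k != 1 -> k != -1 ->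
        linearly_stable beta1 beta2 tau1 tau2 lam k].

End Model.

(* Main.v *)
Require Import Defs.
From mathcomp Require Import all_boot all_order all_algebra.
From mathcomp Require Import all_classical all_reals all_analysis.
From mathcomp Require Import measurable_realfun complex ring lra.
Import Order.TTheory GRing.Theory Num.Theory.
Import numFieldNormedType.Exports.
Local Open Scope classical_set_scope.
Local Open Scope ring_scope.

(** Everything rests on the closed form [kernel_fourierE] of the Fourier
    coefficients, exp(- 2 pi^2 tau k^2).  Summing the Gaussian over the integer
    translates turns an integral over [0, 1] against a 1-periodic function into
    an integral over the whole line, so the coefficient is the Fourier transform
    of the Gaussian at 2 pi k; this transform F solves F' = - tau t F (by
    differentiation under the integral and integration by parts) with F(0) = 1.

    Write x, y for the coefficients of the two kernels, a, b for alpha_1,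
    alpha_2 and p > 0 for the product of the two hyperbolic tangents.  Mode k
    has the real matrix with trace (a x - 1) + (b y - 1) and determinant
    p - (a x - 1) (1 - b y), so it is stable iff the trace is negative and the
    determinant positive, and unstable iff the trace is positive or the
    determinant negative.

    (i) Stability at k = 0, where x = y = 1, says a + b < 2 and
    (a - 1) (1 - b) < p.  Since x, y < 1, the trace stays negative at every
    k <> 0, so an unstable mode has p < (a x - 1) (1 - b y), and one of a x,
    b y exceeds 1.  If it is a x, then b < 1 < a.  If moreover x <= y, then
    p < (a x - 1) (1 - b x); but c |-> (a c - 1) (1 - b c) increases on [0, 1]
    when a + b < 2, which contradicts stability at c = 1.  Hence y < x, that
    is, tau1 < tau2.  The other case is symmetric.

    (ii) By the intermediate value theorem some lam > 0 satisfies
    p = (a - 1) (1 - b / 2) with a > 1 ([exists_balanced_lam]).  Mode 0 is then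
    stable, because 1 - b < 1 - b / 2.  The variances are free, so the
    coefficients of mode 1 can be prescribed in (0, 1), and x close enough to 1
    with y small makes p < (a x - 1) (1 - b y).

    (iii) With the same lam, choose x so small that a x^4 <= 1: the coefficient
    of mode k is x^(k^2), so every mode with |k| >= 2 has determinant at least
    p, and its trace is negative because a + b < 2.  By Bernoulli,
    x = 1 / (1 + (a - 1) / 4) qualifies; then a x - 1 is about 3/4 of a - 1 when
    a is close to 1, whereas p is close to (a - 1) / 2 when b is close to 1, so
    mode 1 is still unstable for small y. *)

(** * Eigenvalues of a real mode *)

Lemma eigenvalues_trace_det (F : closedFieldType) (A : 'M[F]_2) :
  let mu := eigenvalues A in
  mu`_0 + mu`_1 = \tr A /\ mu`_0 * mu`_1 = \det A.
Proof.
have := char_poly_eigenvalues A; have := size_eigenvalues A.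
case: (eigenvalues A) => [|x [|y [|? ?]]]//= _.
rewrite big_cons big_seq1 => charA.
have := @char_poly_trace _ 2 A isT; have := char_poly_det A.
have -> : char_poly A = 'X^2 - (x + y) *: 'X + (x * y)%:P.
  by rewrite charA -mul_polyC polyCM polyCD; ring.
rewrite /= !(coefD, coefN, coefZ, coefC, coefX, coefXn)/= sqrrN expr1n mul1r.
rewrite !(mulr0, mulr1, oppr0, add0r, addr0) => <- H.
by split=> //; apply: oppr_inj.
Qed.

(** With a real sum and a real product, the two numbers are either both real or
    conjugate to each other; in the second case the product is a sum of
    squares. *)
Lemma max_Re_lt0P (R : rcfType) (z w : R[i]) (t d : R) :
  z + w = t%:C%C -> z * w = d%:C%C ->
  Num.max (complex.Re z) (complex.Re w) < 0 <-> t < 0 /\ 0 < d.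
Proof.
case: z w => [a b] [c e] [st si] [dt di] /=; rewrite gt_max.
have eb : e = - b by lra.
subst e; have /eqP : b * (c - a) = 0 by lra.
rewrite mulf_eq0 => /orP[/eqP b0|/eqP ca].
  subst b; split=> [/andP[a0 c0]|[t0 d0]]; first by split; nra.
  by apply/andP; split; rewrite ltNge; apply/negP => h; nra.
have {}ca : c = a by lra.
subst c; split=> [/andP[a0 _]|[t0 d0]]; first by split; nra.
by apply/andP; split; lra.
Qed.

Lemma max_Re_gt0P (R : rcfType) (z w : R[i]) (t d : R) :
  z + w = t%:C%C -> z * w = d%:C%C ->
  0 < Num.max (complex.Re z) (complex.Re w) <-> 0 < t \/ d < 0.
Proof.
case: z w => [a b] [c e] [st si] [dt di] /=; rewrite lt_max.
have eb : e = - b by lra.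
subst e; have /eqP : b * (c - a) = 0 by lra.
rewrite mulf_eq0 => /orP[/eqP b0|/eqP ca].
  subst b; split=> [/orP ac|h].
    have [t0|t0] := ltP 0 t; [by left|right].
    by case: ac => ?; nra.
  apply/orP; have [a0|a0] := ltP 0 a; [by left|right].
  by case: h => h; rewrite ltNge; apply/negP => c0; nra.
have {}ca : c = a by lra.
subst c; rewrite orbb; split=> [a0|[t0|d0]]; [by left; lra|by lra|by nra].
Qed.

(** * Fourier transform of the Gaussian *)

Lemma Rintegral_derivative_eq0 (R : realType) (F f : R -> R) :
  (forall x, is_derive x (1 : R) F (f x)) -> continuous f ->
  lebesgue_measure.-integrable [set: R] (EFin \o f) ->
  F n%:R @[n --> \oo] --> (0 : R) -> F (- n%:R) @[n --> \oo] --> (0 : R) ->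
  (\int[lebesgue_measure]_x f x)%R = 0.
Proof.
move=> dF cf intf Fy FNy; set mu := lebesgue_measure.
have F_FTC (n : nat) :
  (\int[mu]_(x in `[(- n%:R)%R, n%:R%R]) (f x)%:E = (F n%:R - F (- n%:R))%:E)%E.
  case: n => [|n].
    by rewrite mulr0n oppr0 set_itv1 integral_set1 subrr.
  have cF : continuous F.
    by move=> x; apply/differentiable_continuous/derivable1_diffP.
  rewrite (@continuous_FTC2 _ f F) ?EFinB//.
  - by rewrite (@lt_trans _ _ 0) ?oppr_lt0 ?ltr0n.
  - exact: continuous_subspaceT.
  - split; first by move=> x _; exact: ex_derive.
    + exact/cvg_at_right_filter/cF.
    + exact/cvg_at_left_filter/cF.
  - by move=> x _; rewrite derive1E derive_val.
(* The integral over the line is the limit of those over [-n, n]. *)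
pose f_ (n : nat) : R -> \bar R := (EFin \o f) \_ `[(- n%:R)%R, n%:R%R].
have mf := measurable_int _ intf.
have [_ _] : [/\ mu.-integrable setT (EFin \o f),
    (\int[mu]_x `|f_ n x - (EFin \o f) x|)%E @[n --> \oo] --> 0%E &
    (\int[mu]_x f_ n x)%E @[n --> \oo] --> (\int[mu]_x (EFin \o f) x)%E].
  apply: (@dominated_convergence _ _ _ mu setT measurableT f_ _
      (abse \o (EFin \o f))) => //.
  - move=> n; apply/(measurable_restrictT _ _).1 => //.
    exact: measurable_funS mf.
  - apply: aeW => x _; apply: cvg_near_cst; near=> n.
    rewrite /f_ patchE mem_set//= in_itv/= -ler_norml.
    by near: n; exact: nbhs_infty_ger.
  - exact: integrable_abse.
  - apply: aeW => x n _; rewrite /f_ patchE; case: ifP => // _.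
    by rewrite abse0 abse_ge0.
under eq_fun do rewrite -integral_mkcond F_FTC.
move=> lim; suff : (\int[mu]_x (EFin \o f) x = 0)%E by rewrite /Rintegral => ->.
apply: (cvg_unique _ lim); first exact: ereal_hausdorff.
apply: cvg_EFin; first exact: nearW.
by rewrite -[0]subr0; exact: cvgB.
Unshelve. all: by end_near. Qed.

Lemma integrableZl_EFin d (T : measurableType d) (R : realType)
    (mu : {measure set T -> \bar R}) (D : set T) (c : R) (f : T -> R) :
  measurable D -> mu.-integrable D (EFin \o f) ->
  mu.-integrable D (EFin \o (fun x => c * f x)).
Proof.
move=> mD intf.
apply: (@eq_integrable _ _ _ _ _ mD (fun x => c%:E * (EFin \o f) x)%E) => //.
exact: integrableZl.
Qed.

Section gaussian_fourier.
Context {R : realType}.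
Notation mu := (@lebesgue_measure R).
Implicit Types tau t x : R.

Definition gaussian tau x : R :=
  (Num.sqrt (2 * pi * tau))^-1 * expR (- x ^+ 2 / (2 * tau)).

Lemma gaussianE tau : 0 < tau -> gaussian tau = normal_pdf 0 (Num.sqrt tau).
Proof.
move=> tau0; rewrite normal_pdfE ?gt_eqF ?sqrtr_gt0//.
apply/funext => x; rewrite /gaussian /normal_peak /normal_fun subr0.
rewrite sqr_sqrtr ?ltW// -(mulr_natl tau 2) -(mulr_natl (tau * pi) 2).
by rewrite -mulrA (mulrC pi).
Qed.

Lemma gaussian_ge0 tau x : 0 <= gaussian tau x.
Proof. by rewrite mulr_ge0// ?invr_ge0// expR_ge0. Qed.

Lemma gaussianN tau x : gaussian tau (- x) = gaussian tau x.
Proof. by rewrite /gaussian sqrrN. Qed.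

Lemma continuous_gaussian tau : 0 < tau -> continuous (gaussian tau).
Proof.
move=> ?; rewrite gaussianE//.
by apply: continuous_normal_pdf; rewrite gt_eqF ?sqrtr_gt0.
Qed.

Lemma integral_gaussian tau : 0 < tau ->
  (\int[mu]_x (gaussian tau x)%:E = 1)%E.
Proof. by move=> ?; rewrite gaussianE// integral_normal_pdf. Qed.

Lemma integrable_gaussian tau : 0 < tau ->
  mu.-integrable [set: R] (EFin \o gaussian tau).
Proof. by move=> ?; rewrite gaussianE//; exact: integrable_normal_pdf. Qed.

Lemma is_derive_gaussian tau x : 0 < tau ->
  is_derive x (1 : R) (gaussian tau) (- (x / tau) * gaussian tau x).
Proof.
move=> tau0; rewrite /gaussian.
apply: is_derive_eq; rewrite /GRing.scale/=.
set c := _^-1; set e := expR _; field; lra.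
Qed.

Lemma cvg_gaussian tau : 0 < tau -> gaussian tau x @[x --> +oo] --> (0 : R).
Proof.
move=> tau0; rewrite -[X in _ --> X](mulr0 (Num.sqrt (2 * pi * tau))^-1).
apply: cvgM; first exact: cvg_cst.
under eq_fun do rewrite mulNr.
apply: (cvg_comp (fun x : R => x ^+ 2 / (2 * tau)) (fun y => expR (- y)));
  last exact: cvgr_expR.
apply: gt0_cvgMly; first by rewrite invr_gt0 mulr_gt0.
exact: cvgr_expr2.
Qed.

(** Half of the exponent absorbs the factor x, at the price of doubling the
    variance; this dominates the derivative in t of the transform. *)
Lemma normr_mul_gaussian_le tau x : 0 < tau ->
  `|x * gaussian tau x| <= Num.sqrt 2 * Num.sqrt tau * gaussian (2 * tau) x.
Proof.
move=> tau0; rewrite normrM (ger0_norm (gaussian_ge0 _ _)) /gaussian.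
have pi0 : 0 <= 2 * pi :> R by rewrite mulr_ge0 ?pi_ge0.
rewrite (mulrCA _ 2 tau) (sqrtrM (2 * pi * tau))//.
set c := Num.sqrt (2 * pi * tau); set s := Num.sqrt tau.
have c0 : 0 < c by rewrite sqrtr_gt0 mulr_gt0// mulr_gt0// pi_gt0.
have s0 : 0 < s by rewrite sqrtr_gt0.
have <- : s ^+ 2 = tau by rewrite sqr_sqrtr ?ltW.
have r0 : 0 < Num.sqrt 2 :> R by rewrite sqrtr_gt0.
have -> : - x ^+ 2 / (2 * s ^+ 2) =
    - x ^+ 2 / (2 * (2 * s ^+ 2)) - x ^+ 2 / (4 * s ^+ 2) by field; lra.
rewrite expRD; set e := expR (_ / (2 * (2 * _))).
have -> : Num.sqrt 2 * s * ((Num.sqrt 2 * c)^-1 * e) = c^-1 * e * s.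
  by field; rewrite !gt_eqF.
have -> (y : R) : `|x| * (c^-1 * (e * y)) = c^-1 * e * (`|x| * y) by ring.
rewrite ler_pM2l ?mulr_gt0 ?invr_gt0 ?expR_gt0//.
rewrite expRN ler_pdivrMr ?expR_gt0//.
(* exp u >= 1 + u and 1 + u^2 / 4 >= |u|, for u = x / s. *)
apply: (@le_trans _ _ (s * (1 + x ^+ 2 / (4 * s ^+ 2)))); last first.
  by rewrite ler_pM2l// expR_ge1Dx.
have -> : s * (1 + x ^+ 2 / (4 * s ^+ 2)) = (4 * s ^+ 2 + `|x| ^+ 2) / (4 * s).
  by rewrite real_normK ?num_real//; field; rewrite gt_eqF.
rewrite ler_pdivlMr ?mulr_gt0//.
by move: (sqr_ge0 (2 * s - `|x|)); set y := `|x|; lra.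
Qed.

Lemma integrable_gaussianM tau (h : R -> R) (c : R) : 0 < tau -> continuous h ->
  (forall x, `|h x| <= c) ->
  mu.-integrable [set: R] (EFin \o (fun x => gaussian tau x * h x)).
Proof.
move=> tau0 ch hc; apply: (@le_integrable _ _ R mu setT measurableT _
    (fun x => c%:E * (gaussian tau x)%:E)%E).
- apply/measurable_EFinP; apply: continuous_measurable_fun => x.
  by apply: continuousM; [exact: continuous_gaussian|exact: ch].
- move=> x _ /=; rewrite lee_fin !normrM mulrC ler_wpM2r//.
  by rewrite (le_trans (hc x))// ler_norm.
- by apply: integrableZl => //; exact: integrable_gaussian.
Qed.

Lemma continuous_cosM t : continuous (fun x => cos (t * x)).
Proof.
move=> x; apply: (@continuous_comp _ _ _ ( *%R t) cos); last first.
  exact: continuous_cos.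
exact: mulrl_continuous.
Qed.

Lemma continuous_sinM t : continuous (fun x => sin (t * x)).
Proof.
move=> x; apply: (@continuous_comp _ _ _ ( *%R t) sin); last first.
  exact: continuous_sin.
exact: mulrl_continuous.
Qed.

Lemma integrable_gaussian_cos tau t : 0 < tau ->
  mu.-integrable [set: R] (EFin \o (fun x => gaussian tau x * cos (t * x))).
Proof.
move=> tau0; apply: (@integrable_gaussianM _ _ 1) => //.
  exact: continuous_cosM.
by move=> x; exact: cos_max.
Qed.

Lemma integrable_gaussian_sin tau t : 0 < tau ->
  mu.-integrable [set: R] (EFin \o (fun x => gaussian tau x * sin (t * x))).
Proof.
move=> tau0; apply: (@integrable_gaussianM _ _ 1) => //.
  exact: continuous_sinM.
by move=> x; exact: sin_max.
Qed.

Lemma continuous_idM_gaussian_sin tau t : 0 < tau ->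
  continuous (fun x => x * gaussian tau x * sin (t * x)).
Proof.
move=> tau0 x; apply: cvgM; last exact: continuous_sinM.
by apply: cvgM; [exact: cvg_id|exact: continuous_gaussian].
Qed.

Lemma integrable_idM_gaussian_sin tau t : 0 < tau ->
  mu.-integrable [set: R] (EFin \o (fun x => x * gaussian tau x * sin (t * x))).
Proof.
move=> tau0; apply: (@le_integrable _ _ R mu setT measurableT _
    (fun x => (Num.sqrt 2 * Num.sqrt tau)%:E * (gaussian (2 * tau) x)%:E)%E).
- apply/measurable_EFinP; apply: continuous_measurable_fun.
  exact: continuous_idM_gaussian_sin.
- move=> x _ /=; rewrite lee_fin normrM.
  apply: (@le_trans _ _ `|x * gaussian tau x|).
    by rewrite ler_piMr// sin_max.
  by rewrite (le_trans (normr_mul_gaussian_le tau x tau0))// ler_norm.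
- by apply: integrableZl => //; apply: integrable_gaussian; rewrite mulr_gt0.
Qed.

(** Integration by parts: the derivative of gaussian tau x * sin (t x), which
    vanishes at infinity, integrates to 0. *)
Lemma Rintegral_gaussian_sin tau t : 0 < tau ->
  \int[mu]_x (x * gaussian tau x * sin (t * x)) =
  tau * t * \int[mu]_x (gaussian tau x * cos (t * x)).
Proof.
move=> tau0.
have int0 := integrable_gaussian_cos tau t tau0.
have c1 := continuous_idM_gaussian_sin tau t tau0.
have int1 := integrable_idM_gaussian_sin tau t tau0.
have int0' : mu.-integrable setT
    (EFin \o (fun x => t * (gaussian tau x * cos (t * x)))).
  exact: integrableZl_EFin.
have int1' : mu.-integrable setT
    (EFin \o (fun x => tau^-1 * (x * gaussian tau x * sin (t * x)))).
  exact: integrableZl_EFin.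
have Fy : (gaussian tau n%:R * sin (t * n%:R)) @[n --> \oo] --> (0 : R).
  apply: norm_cvg0.
  apply: (@squeeze_cvgr _ _ _ _ (cst 0) (fun n => gaussian tau n%:R)).
  - apply: nearW => n; rewrite normr_ge0/= normrM ger0_norm ?gaussian_ge0//.
    by rewrite ler_piMr ?gaussian_ge0// sin_max.
  - exact: cvg_cst.
  - exact: (cvg_comp _ _ cvgr_idn (cvg_gaussian tau tau0)).
have : \int[mu]_x (t * (gaussian tau x * cos (t * x)) -
    tau^-1 * (x * gaussian tau x * sin (t * x))) = 0.
  apply: (@Rintegral_derivative_eq0 _
      (fun x => gaussian tau x * sin (t * x))) => //.
  - move=> x; have ? := is_derive_gaussian tau x tau0.
    apply: is_derive_eq; rewrite /GRing.scale/=.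
    by field; rewrite gt_eqF.
  - move=> x; apply: cvgB; apply: cvgM;
      [exact: cvg_cst| |exact: cvg_cst|exact: c1].
    by apply: cvgM; [exact: continuous_gaussian|exact: continuous_cosM].
  - exact: (integrableB measurableT int0' int1').
  - under eq_fun do rewrite gaussianN mulrN sinN mulrN.
    by rewrite -oppr0; exact: cvgN.
rewrite RintegralB ?RintegralZl// => /subr0_eq.
move=> /(congr1 ( *%R tau)); rewrite mulrA => ->.
by rewrite mulrA divff ?mul1r// gt_eqF.
Qed.

Definition gaussian_cos tau t := \int[mu]_x (gaussian tau x * cos (t * x)).

Lemma is_derive_gaussian_cos tau t : 0 < tau ->
  is_derive t (1 : R) (gaussian_cos tau) (- (tau * t) * gaussian_cos tau t).
Proof.
move=> tau0; rewrite mulNr -Rintegral_gaussian_sin//.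
pose f (s x : R) := gaussian tau x * cos (s * x).
pose G x := Num.sqrt 2 * Num.sqrt tau * gaussian (2 * tau) x.
have df (s x : R) : is_derive s (1 : R) (f ^~ x)
    (- (x * gaussian tau x * sin (s * x))).
  by apply: is_derive_eq; rewrite /GRing.scale/=; ring.
have dfE (s x : R) : partial1of2 f s x = - (x * gaussian tau x * sin (s * x)).
  by rewrite partial1of2E derive_val.
have f_derivable (s x : R) : derivable (f ^~ x) s (1 : R) by [].
have dfG (s x : R) : `|partial1of2 f s x| <= G x.
  rewrite dfE normrN normrM.
  apply: le_trans (normr_mul_gaussian_le tau x tau0).
  by rewrite ler_piMr// sin_max.
have G_ge0 (x : R) : 0 <= G x by rewrite !mulr_ge0// gaussian_ge0.
have intf s := integrable_gaussian_cos tau s tau0.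
have intG : mu.-integrable [set: R] (EFin \o G).
  apply: integrableZl_EFin => //.
  by apply: integrable_gaussian; rewrite mulr_gt0.
have It : `]t - 1, t + 1[%classic t by rewrite /= in_itv/=; lra.
apply: DeriveDef.
  exact: (@derivable_under_integral R _ _ mu f setT measurableT t (t - 1)
    (t + 1) It (fun s _ => intf s) (fun s x _ _ => f_derivable s x)
    G G_ge0 intG (fun s x _ _ => dfG s x)).
rewrite -derive1E (@differentiation_under_integral R _ _ mu f setT measurableT
  t (t - 1) (t + 1) It (fun s _ => intf s) (fun s x _ _ => f_derivable s x)
  G G_ge0 intG (fun s x _ _ => dfG s x)).
under eq_Rintegral do rewrite dfE -mulN1r.
by rewrite RintegralZl ?mulN1r//; exact: integrable_idM_gaussian_sin.
Qed.

Lemma gaussian_cosE tau t : 0 < tau ->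
  gaussian_cos tau t = expR (- (tau * t ^+ 2 / 2)).
Proof.
move=> tau0.
(* The differential equation makes this product constant. *)
pose f s := gaussian_cos tau s * expR (tau * s ^+ 2 / 2).
have df (s : R) : is_derive s (1 : R) f 0.
  have ? := is_derive_gaussian_cos tau s tau0.
  apply: is_derive_eq; rewrite /GRing.scale/=.
  by set e := expR _; set c := gaussian_cos _ _; field.
have : f t = f 0 by exact: is_derive_0_is_cst.
rewrite /f expr0n /= mulr0 mul0r expR0 mulr1 {2}/gaussian_cos.
under eq_Rintegral do rewrite mul0r cos0 mulr1.
rewrite /Rintegral integral_gaussian//= => /(canRL (mulfK _)) ->.
  by rewrite mul1r expRN.
by rewrite gt_eqF ?expR_gt0.
Qed.

(** The Lebesgue measure is invariant under x |-> - x. *)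
Lemma Rintegral_odd_eq0 (f : R -> R) :
  mu.-integrable [set: R] (EFin \o f) -> (forall x, f (- x) = - f x) ->
  \int[mu]_x f x = 0.
Proof.
move=> intf oddf.
have mf := measurable_int _ intf.
suff : \int[mu]_x f x = - \int[mu]_x f x by lra.
rewrite -mulN1r -RintegralZl// /Rintegral; congr fine.
transitivity (\int[mu]_x (f (- x))%:E)%E; last first.
  by apply: eq_integral => x _; rewrite mulN1r oddf.
transitivity
    (\int[pushforward mu (-%R : _ -> measurableTypeR R)]_x (f x)%:E)%E.
  by apply: eq_measure_integral => A mA _ /=; exact/esym/lebesgue_measureN.
rewrite integral_pushforward//= preimage_setT.
rewrite (_ : _ \o _ = EFin \o (fun x => -1 * f x)).
  exact: integrableZl_EFin.
by apply/funext => x /=; rewrite oddf mulN1r.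
Qed.

Lemma Rintegral_gaussian_sin_eq0 tau t : 0 < tau ->
  \int[mu]_x (gaussian tau x * sin (t * x)) = 0.
Proof.
move=> tau0; apply: Rintegral_odd_eq0; first exact: integrable_gaussian_sin.
by move=> x; rewrite gaussianN mulrN sinN mulrN.
Qed.

End gaussian_fourier.

(** * Fourier coefficients of the periodized Gaussian *)

Lemma periodicz (U V : zmodType) (f : U -> V) (T : U) :
  periodic f T -> forall (m : int) (a : U), f (a + T *~ m) = f a.
Proof.
move=> pf [] n a; first exact: (periodicn pf).
by have := periodicn pf n.+1 (a - T *+ n.+1); rewrite subrK NegzE mulrNz.
Qed.

Section unfolding.
Context {R : realType}.
Notation mu := (@lebesgue_measure R).

(** The enumeration 0, -1, 1, -2, 2, ... turns the sum over the integers into a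
    series, to which monotone convergence applies. *)
Definition int_of_nat (n : nat) : int := if odd n then Negz n./2 else Posz n./2.

Lemma set_bij_int_of_nat : set_bij setT setT int_of_nat.
Proof.
split=> // [m n _ _|[m|m] _]; rewrite /int_of_nat.
- case: ifP => om; case: ifP => on // [h];
    by rewrite -(odd_double_half m) om h -on odd_double_half.
- by exists m.*2 => //; rewrite odd_double doubleK.
- by exists m.*2.+1 => //=; rewrite odd_double /= uphalf_double.
Qed.

Lemma integral_translate (f : R -> R) (a : R) : continuous f ->
  (\int[mu]_(x in `[0%R, 1%R]) (f (x + a))%:E =
   \int[mu]_(x in `[a, (a + 1)%R]) (f x)%:E)%E.
Proof.
move=> cf.
have dF (x : R) : is_derive x (1 : R) (fun x => x + a) 1.
  by apply: is_derive_eq; rewrite addr0.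
have cF : continuous (fun x : R => x + a).
  by move=> x; apply/differentiable_continuous/derivable1_diffP.
have d1 : (fun x : R => x + a)^`()%classic = cst (1 : R).
  by apply/funext => x; rewrite derive1E derive_val.
have := @integration_by_substitution_increasing R (fun x => x + a) f 0 1 ler01.
rewrite d1 /= add0r (addrC 1) => ->.
- by apply: eq_integral => x _ /=; rewrite !fctE mulr1.
- by move=> x y _ _; rewrite ltrD2r.
- by move=> x _; exact: cvg_cst.
- exact: is_cvg_cst.
- exact: is_cvg_cst.
- split; first by move=> x _; exact: ex_derive.
  + exact/cvg_at_right_filter/cF.
  + exact/cvg_at_left_filter/cF.
- exact: continuous_subspaceT.
Qed.

(** The translates of [0, 1[ by the integers tile the line. *)
Lemma integral_sum_int_translates (f : R -> R) (e : nat -> int) :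
  set_bij setT setT e -> continuous f -> (forall x, 0 <= f x) ->
  (\int[mu]_(x in `[0%R, 1%R]) \sum_(n <oo) (f (x + (e n)%:~R))%:E =
   \int[mu]_x (f x)%:E)%E.
Proof.
move=> [_ einj esurj] cf f0.
have mf (a : R) : measurable_fun setT (fun x : R => f (x + a)).
  apply: measurableT_comp; first exact: continuous_measurable_fun.
  exact: measurable_funD.
have mf0 : measurable_fun setT (EFin \o f).
  by apply/measurable_EFinP; exact: continuous_measurable_fun.
rewrite integral_nneseries//; last 2 first.
- by move=> n; apply/measurable_EFinP; apply: measurable_funTS; exact: mf.
- by move=> n x _; rewrite lee_fin.
pose I n : set R := `[((e n)%:~R : R), ((e n)%:~R + 1)%R[%classic.
have IT : \bigcup_n I n = setT.
  apply/seteqP; split=> // x _.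
  have [n _ en] := esurj (Num.floor x) Logic.I.
  by exists n => //; rewrite /I/= in_itv/= en -intrD1 floor_itv.
have tI : trivIset setT I.
  move=> i j _ _ [x []]; rewrite /I/= !in_itv/= -!intrD1.
  by move=> /floor_def Hi /floor_def Hj; apply: einj; rewrite ?inE// -Hi -Hj.
rewrite -IT ge0_integral_bigcup//=.
- apply: eq_eseriesr => n _; rewrite integral_translate//.
  by rewrite integral_itv_bndo_bndc//; exact: measurable_funS mf0.
- by move=> k; exact: measurable_itv.
- by rewrite IT.
- by move=> x _; rewrite lee_fin.
Qed.

End unfolding.

Section periodized.
Context {R : realType}.
Notation mu := (@lebesgue_measure R).
Implicit Types (tau x r : R) (h : R -> R).

(** Keeping the sum in the extended reals separates the exchange of sum and
    integral from finiteness, which integrals need only almost everywhere. *)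
Definition gaussian_orbit_sum tau r : \bar R :=
  (\esum_(a in [set: int]) (gaussian tau (r + a%:~R))%:E)%E.

Lemma periodized_gaussianE tau r :
  periodized_gaussian tau 0 r = fine (gaussian_orbit_sum tau r).
Proof.
congr fine; apply: eq_esum => a _.
by rewrite /gaussian sub0r -opprD sqrrN.
Qed.

Lemma gaussian_orbit_sumE tau r :
  gaussian_orbit_sum tau r =
  (\sum_(n <oo) (gaussian tau (r + (int_of_nat n)%:~R))%:E)%E.
Proof.
rewrite /gaussian_orbit_sum (reindex_esum _ _ _ _ set_bij_int_of_nat).
by rewrite nneseries_esumT// => n; rewrite lee_fin gaussian_ge0.
Qed.

Lemma measurable_gaussian_orbit_sum tau : 0 < tau ->
  measurable_fun setT (gaussian_orbit_sum tau).
Proof.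
move=> tau0; rewrite (funext (gaussian_orbit_sumE tau)).
apply: (@ge0_emeasurable_sum _ _ _ setT
  (fun n r => (gaussian tau (r + (int_of_nat n)%:~R))%:E) predT).
  by move=> k x _ _; rewrite lee_fin gaussian_ge0.
move=> k _; apply/measurable_EFinP; apply: measurableT_comp.
  by apply: continuous_measurable_fun; exact: continuous_gaussian.
exact: measurable_funD.
Qed.

Lemma integral_gaussian_orbit_sumM tau h : 0 < tau -> continuous h ->
  (forall x, 0 <= h x) -> periodic h 1 ->
  (\int[mu]_(r in `[0%R, 1%R]) (gaussian_orbit_sum tau r * (h r)%:E) =
   \int[mu]_x (gaussian tau x * h x)%:E)%E.
Proof.
move=> tau0 ch h0 h1.
have hZ (r : R) (a : int) : h (r + a%:~R) = h r by exact: periodicz.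
rewrite -(integral_sum_int_translates _ _ set_bij_int_of_nat); last 2 first.
- by move=> x; apply: cvgM; [exact: continuous_gaussian|exact: ch].
- by move=> x; rewrite mulr_ge0// gaussian_ge0.
apply: eq_integral => r _.
rewrite gaussian_orbit_sumE muleC -nneseriesZl; last first.
  by move=> n _; rewrite lee_fin gaussian_ge0.
by apply: eq_eseriesr => n _; rewrite hZ mulrC EFinM.
Qed.

(** Its integral over [0, 1] is the total mass of the Gaussian. *)
Lemma gaussian_orbit_sum_fin_num tau : 0 < tau ->
  {ae mu, forall r, `[0%R, 1%R]%classic r ->
    gaussian_orbit_sum tau r \is a fin_num}.
Proof.
move=> tau0; apply: integrable_ae => //; apply/integrableP; split.
  by apply: measurable_funTS; exact: measurable_gaussian_orbit_sum.
rewrite (_ : integral _ _ _ = 1%E) ?ltry//.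
rewrite -[RHS](integral_gaussian tau tau0).
transitivity (\int[mu]_x (gaussian tau x * 1)%:E)%E.
  rewrite -(@integral_gaussian_orbit_sumM _ (cst 1))//; last first.
    by move=> x; exact: cvg_cst.
  apply: eq_integral => r _; rewrite mule1 gee0_abs//.
  by apply: esum_ge0 => a _; rewrite lee_fin gaussian_ge0.
by apply: eq_integral => x _; rewrite mulr1.
Qed.

Lemma measurable_periodized_gaussianM tau h : 0 < tau -> continuous h ->
  measurable_fun setT (fun r => periodized_gaussian tau 0 r * h r).
Proof.
move=> tau0 ch; rewrite (funext (periodized_gaussianE tau)).
apply: measurable_funM; last exact: continuous_measurable_fun.
by apply: measurableT_comp => //; exact: measurable_gaussian_orbit_sum.
Qed.

Lemma integral_periodized_gaussianM tau h : 0 < tau -> continuous h ->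
  (forall x, 0 <= h x) -> periodic h 1 ->
  (\int[mu]_(r in `[0%R, 1%R]) (periodized_gaussian tau 0 r * h r)%:E =
   \int[mu]_x (gaussian tau x * h x)%:E)%E.
Proof.
move=> tau0 ch h0 h1; rewrite -integral_gaussian_orbit_sumM//.
have mh : measurable_fun setT h by exact: continuous_measurable_fun.
have mS := measurable_gaussian_orbit_sum tau tau0.
apply: ae_eq_integral => //.
- apply/measurable_EFinP; apply: measurable_funTS.
  exact: measurable_periodized_gaussianM.
- apply: measurable_funTS; apply: emeasurable_funM => //.
  exact/measurable_EFinP.
apply: (@filterS _ _ (ae_filter_ringOfSetsType mu))
  (gaussian_orbit_sum_fin_num tau tau0) => r fin Dr.
by rewrite periodized_gaussianE EFinM fineK// fin.
Qed.

(** Unfolding needs nonnegative integrands; a function bounded by 1 is the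
    difference of the nonnegative functions h + 1 and 1. *)
Lemma Rintegral_periodized_gaussianM tau h : 0 < tau -> continuous h ->
  (forall x, `|h x| <= 1) -> periodic h 1 ->
  \int[mu]_(r in `[0%R, 1%R]) (periodized_gaussian tau 0 r * h r) =
  \int[mu]_x (gaussian tau x * h x).
Proof.
move=> tau0 ch h1 ph.
have c1 : continuous (cst 1 : R -> R) by move=> x; exact: cvg_cst.
have ch1 : continuous (fun x => h x + 1).
  by move=> x; apply: cvgD; [exact: ch|exact: cvg_cst].
have ph1 : periodic (fun x => h x + 1) 1 by move=> x; rewrite ph.
have h0 x : 0 <= h x + 1 by have := h1 x; rewrite ler_norml => /andP[]; lra.
have intR (g : R -> R) : continuous g -> (forall x, 0 <= g x) ->
    (forall x, `|g x| <= 2) -> periodic g 1 ->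
    mu.-integrable setT (EFin \o (fun x => gaussian tau x * g x)) /\
    mu.-integrable `[0%R, 1%R]
      (EFin \o (fun x => periodized_gaussian tau 0 x * g x)).
  move=> cg g0 g2 pg.
  have ig : mu.-integrable setT (EFin \o (fun x => gaussian tau x * g x)).
    exact: (integrable_gaussianM _ _ 2).
  split=> //; apply/integrableP; split.
    apply/measurable_EFinP; apply: measurable_funTS.
    exact: measurable_periodized_gaussianM.
  have /integrableP[_] := ig; congr (_ < _)%E.
  transitivity (\int[mu]_x (gaussian tau x * g x)%:E)%E.
    apply: eq_integral => x _ /=.
    by rewrite ger0_norm// mulr_ge0// gaussian_ge0.
  rewrite -integral_periodized_gaussianM//; apply: eq_integral => r _ /=.
  rewrite ger0_norm// mulr_ge0// periodized_gaussianE.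
  by apply: fine_ge0; apply: esum_ge0 => a _; rewrite lee_fin gaussian_ge0.
have n1 (x : R) : `|cst 1 x : R| <= 2 by rewrite /= normr1; lra.
have [i1 j1] := intR (cst 1) c1 (fun=> ler01) n1 (fun=> erefl).
have n2 (x : R) : `|h x + 1| <= 2.
  by rewrite ger0_norm//; have := h1 x; rewrite ler_norml => /andP[]; lra.
have [i2 j2] := intR (fun x => h x + 1) ch1 h0 n2 ph1.
transitivity (\int[mu]_(r in `[0%R, 1%R])
    (periodized_gaussian tau 0 r * (h r + 1) -
     periodized_gaussian tau 0 r * 1)).
  by apply: eq_Rintegral => r _; ring.
transitivity
    (\int[mu]_x (gaussian tau x * (h x + 1) - gaussian tau x * 1)); last first.
  by apply: eq_Rintegral => r _; ring.
rewrite RintegralB// RintegralB//.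
by rewrite /Rintegral !integral_periodized_gaussianM.
Qed.

(** The cosine part is the transform of the Gaussian at 2 pi k; the sine part
    is the integral of an odd function. *)
Lemma kernel_fourierE tau (k : int) : 0 < tau ->
  kernel_fourier tau k = (expR (- (2 * pi ^+ 2 * tau * k%:~R ^+ 2)))%:C%C.
Proof.
move=> tau0; rewrite /kernel_fourier.
have per (f : R -> R) : periodic f (pi *+ 2) ->
    periodic (fun r => f (2 * pi * k%:~R * r)) 1.
  move=> pf r; rewrite mulrDr mulr1.
  rewrite -[RHS](periodicz _ _ _ _ pf k); congr (f (_ + _)).
  by rewrite -mulrzl -(mulr_natl pi 2); ring.
rewrite !Rintegral_periodized_gaussianM//.
- congr Complex; last first.
    by apply/eqP; rewrite oppr_eq0 Rintegral_gaussian_sin_eq0.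
  by rewrite -/(gaussian_cos _ _) gaussian_cosE//; congr expR; field.
- exact: continuous_sinM.
- by move=> x; exact: sin_max.
- exact/per/sinD2pi.
- exact: continuous_cosM.
- by move=> x; exact: cos_max.
- exact/per/cosD2pi.
Qed.

End periodized.

(** * Stability of a mode through trace and determinant *)

Section modes.
Context {R : realType}.
Implicit Types (beta tau lam : R) (k : int).

Definition gaussian_coef tau k : R := expR (- (2 * pi ^+ 2 * tau * k%:~R ^+ 2)).

Definition mode_trace beta1 beta2 tau1 tau2 lam k : R :=
  (alpha beta1 lam * gaussian_coef tau1 k - 1) +
  (alpha beta2 lam * gaussian_coef tau2 k - 1).

Definition mode_det beta1 beta2 tau1 tau2 lam k : R :=
  tanh (beta1 * lam) * tanh (beta2 * lam) -
  (alpha beta1 lam * gaussian_coef tau1 k - 1) *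
  (1 - alpha beta2 lam * gaussian_coef tau2 k).

Lemma mode_eigenvalues beta1 beta2 tau1 tau2 lam k : 0 < tau1 -> 0 < tau2 ->
  let mu := eigenvalues (mode_matrix beta1 beta2 tau1 tau2 lam k) in
  mu`_0 + mu`_1 = (mode_trace beta1 beta2 tau1 tau2 lam k)%:C%C /\
  mu`_0 * mu`_1 = (mode_det beta1 beta2 tau1 tau2 lam k)%:C%C.
Proof.
move=> t1 t2 mu.
have [] := eigenvalues_trace_det _ (mode_matrix beta1 beta2 tau1 tau2 lam k).
rewrite -/mu => -> ->; rewrite /mxtrace (expand_det_row _ ord0).
rewrite !big_ord_recl !big_ord0 /cofactor !det_mx11 !mxE/=.
rewrite !kernel_fourierE// -!/(gaussian_coef _ _) /mode_trace /mode_det.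
by split; apply/eqP; rewrite eq_complex /=; apply/andP; split; apply/eqP; ring.
Qed.

Lemma linearly_stableP beta1 beta2 tau1 tau2 lam k : 0 < tau1 -> 0 < tau2 ->
  linearly_stable beta1 beta2 tau1 tau2 lam k <->
  mode_trace beta1 beta2 tau1 tau2 lam k < 0 /\
  0 < mode_det beta1 beta2 tau1 tau2 lam k.
Proof.
move=> t1 t2; have [tr det] := mode_eigenvalues beta1 beta2 _ _ lam k t1 t2.
exact: (max_Re_lt0P _ _ _ _ _ tr det).
Qed.

Lemma linearly_unstableP beta1 beta2 tau1 tau2 lam k : 0 < tau1 -> 0 < tau2 ->
  linearly_unstable beta1 beta2 tau1 tau2 lam k <->
  0 < mode_trace beta1 beta2 tau1 tau2 lam k \/
  mode_det beta1 beta2 tau1 tau2 lam k < 0.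
Proof.
move=> t1 t2; have [tr det] := mode_eigenvalues beta1 beta2 _ _ lam k t1 t2.
exact: (max_Re_gt0P _ _ _ _ _ tr det).
Qed.

Lemma gaussian_coef0 tau : gaussian_coef tau 0 = 1.
Proof. by rewrite /gaussian_coef expr0n mulr0 oppr0 expR0. Qed.

Lemma gaussian_coefN tau k : gaussian_coef tau (- k) = gaussian_coef tau k.
Proof. by rewrite /gaussian_coef mulrNz sqrrN. Qed.

Lemma gaussian_coef_gt0 tau k : 0 < gaussian_coef tau k.
Proof. exact: expR_gt0. Qed.

Lemma gaussian_coef_le1 tau k : 0 < tau -> gaussian_coef tau k <= 1.
Proof.
move=> tau0; rewrite -expR0 ler_expR oppr_le0 mulr_ge0 ?sqr_ge0//.
by rewrite mulr_ge0 ?(ltW tau0)// mulr_ge0// sqr_ge0.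
Qed.

Lemma gaussian_coef_lt1 tau k : 0 < tau -> k != 0 -> gaussian_coef tau k < 1.
Proof.
move=> tau0 k0; rewrite -expR0 ltr_expR oppr_lt0.
rewrite mulr_gt0//; last by rewrite exprn_even_gt0//= intr_eq0.
by rewrite mulr_gt0// mulr_gt0// exprn_gt0// pi_gt0.
Qed.

Lemma le_gaussian_coef tau1 tau2 k : tau1 <= tau2 ->
  gaussian_coef tau2 k <= gaussian_coef tau1 k.
Proof.
move=> tau12; rewrite ler_expR lerN2 ler_wpM2r ?sqr_ge0// ler_wpM2l//.
by rewrite mulr_ge0// sqr_ge0.
Qed.

Lemma gaussian_coefE tau k :
  gaussian_coef tau k = gaussian_coef tau 1 ^+ (`|k|%N ^ 2).
Proof.
rewrite /gaussian_coef -expRM_natl; congr expR.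
rewrite expr1n mulr1 mulrN natrX natr_absz intr_norm real_normK ?num_real//.
by rewrite mulrC.
Qed.

Lemma exists_gaussian_coef1 (q : R) : 0 < q < 1 ->
  exists2 tau, 0 < tau & gaussian_coef tau 1 = q.
Proof.
move=> /andP[q0 q1]; exists (- ln q / (2 * pi ^+ 2)).
  by rewrite divr_gt0 ?mulr_gt0 ?exprn_gt0 ?pi_gt0// oppr_gt0 ln_lt0// q0.
rewrite /gaussian_coef expr1n mulr1 mulrC divfK ?opprK ?lnK//.
by rewrite gt_eqF// mulr_gt0 ?exprn_gt0 ?pi_gt0.
Qed.

(** * Choice of lam *)

Lemma cosh_ge1 (x : R) : 1 <= cosh x.
Proof.
rewrite /cosh expRN ler_pdivlMr// mul1r.
have e0 := expR_gt0 x; set e := expR x in e0 *.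
rewrite -subr_ge0 (_ : _ - _ = (e - 1) ^+ 2 / e); last by field; rewrite gt_eqF.
by rewrite divr_ge0 ?sqr_ge0 ?ltW.
Qed.

Lemma cosh_gt0 (x : R) : 0 < cosh x.
Proof. exact: lt_le_trans (cosh_ge1 x). Qed.

Lemma le_cosh (x y : R) : 0 <= x <= y -> cosh x <= cosh y.
Proof.
move=> /andP[x0 xy]; rewrite /cosh ler_pM2r// !expRN.
have ex : 1 <= expR x by rewrite -expR0 ler_expR.
have exy : expR x <= expR y by rewrite ler_expR.
set a := expR x in ex exy *; set b := expR y in exy *.
have a0 : 0 < a by lra.
have b0 : 0 < b by lra.
rewrite -subr_ge0 (_ : _ - _ = (b - a) * (1 - (a * b)^-1)); last by field; lra.
by rewrite mulr_ge0 ?subr_ge0// invf_le1 ?mulr_gt0//; nra.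
Qed.

Lemma tanh_gt0 (x : R) : 0 < x -> 0 < tanh x.
Proof.
by move=> x0; rewrite divr_gt0 ?cosh_gt0// divr_gt0// subr_gt0 ltr_expR; lra.
Qed.

Lemma alpha_gt0 beta lam : 0 < beta -> 0 < alpha beta lam.
Proof. by move=> b0; rewrite divr_gt0// exprn_gt0// cosh_gt0. Qed.

Lemma alpha_le beta lam : 0 < beta -> alpha beta lam <= beta.
Proof.
move=> b0; rewrite ler_pdivrMr ?exprn_gt0 ?cosh_gt0//.
by rewrite ler_peMr ?(ltW b0)// exprn_ege1// cosh_ge1.
Qed.

Lemma continuous_cosh : continuous (cosh : R -> R).
Proof.
move=> x; apply: cvgM; last exact: cvg_cst.
apply: cvgD; first exact: continuous_expR.
by apply: (@cvg_comp _ _ _ -%R expR);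
  [exact: opp_continuous|exact: continuous_expR].
Qed.

Lemma continuous_sinh : continuous (sinh : R -> R).
Proof.
move=> x; apply: cvgM; last exact: cvg_cst.
apply: cvgB; first exact: continuous_expR.
by apply: (@cvg_comp _ _ _ -%R expR);
  [exact: opp_continuous|exact: continuous_expR].
Qed.

Lemma continuous_tanh : continuous (tanh : R -> R).
Proof.
move=> x; apply: cvgM; first exact: continuous_sinh.
by apply: cvgV; [rewrite gt_eqF// cosh_gt0|exact: continuous_cosh].
Qed.

Lemma continuous_alpha beta : continuous (alpha beta).
Proof.
move=> lam; apply: cvgM; first exact: cvg_cst.
apply: cvgV; first by rewrite gt_eqF// exprn_gt0// cosh_gt0.
apply: (@cvg_comp _ _ _ (fun lam => cosh (lam * beta)) (fun x => x ^+ 2));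
  last exact: sqr_continuous.
apply: (@cvg_comp _ _ _ (fun lam => lam * beta) cosh);
  last exact: continuous_cosh.
exact: mulrr_continuous.
Qed.

(** At lam = 0 the left side vanishes and the right side is positive; once lam
    is so large that alpha_1 <= 1 the order is reversed.  At a crossing
    alpha_1 > 1, because the left side is positive there.  The factor
    1 - alpha_2 / 2 lies strictly between the bound 1 - alpha_2 needed for
    stability of mode 0 and the value 1 that mode 1 approaches as its first
    Fourier coefficient tends to 1 and its second one to 0. *)
Lemma exists_balanced_lam beta1 beta2 : 1 < beta1 -> 0 < beta2 < 1 ->
  exists lam, [/\ 0 < lam, 1 < alpha beta1 lam &
    tanh (beta1 * lam) * tanh (beta2 * lam) =
    (alpha beta1 lam - 1) * (1 - alpha beta2 lam / 2)].
Proof.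
move=> b1 /andP[b20 b2].
pose f lam := (alpha beta1 lam - 1) * (1 - alpha beta2 lam / 2) -
  tanh (beta1 * lam) * tanh (beta2 * lam).
have cf : continuous f.
  move=> lam; apply: cvgB; apply: cvgM.
  - by apply: cvgB; [exact: continuous_alpha|exact: cvg_cst].
  - apply: cvgB; first exact: cvg_cst.
    by apply: cvgM; [exact: continuous_alpha|exact: cvg_cst].
  - apply: (@cvg_comp _ _ _ (fun lam => beta1 * lam) tanh);
      last exact: continuous_tanh.
    exact: mulrl_continuous.
  - apply: (@cvg_comp _ _ _ (fun lam => beta2 * lam) tanh);
      last exact: continuous_tanh.
    exact: mulrl_continuous.
have [L L0 aL] : exists2 L, 0 < L & alpha beta1 L <= 1.
  (* cosh (lam beta1) >= exp (lam beta1) / 2 = beta1 for this lam. *)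
  exists (ln (2 * beta1) / beta1).
    by rewrite divr_gt0 ?ln_gt0//; lra.
  rewrite /alpha divfK; last by rewrite gt_eqF; lra.
  rewrite ler_pdivrMr ?exprn_gt0 ?cosh_gt0// mul1r.
  have h : beta1 <= cosh (ln (2 * beta1)).
    rewrite /cosh lnK ?posrE; last by lra.
    by have := expR_gt0 (- ln (2 * beta1)); lra.
  apply: (le_trans (_ : _ <= beta1 ^+ 2)); first by rewrite expr2; nra.
  by rewrite lerXn2r// nnegrE; lra.
have a2 lam : alpha beta2 lam < 1 by apply: le_lt_trans b2; apply: alpha_le.
have a20 lam : 0 < alpha beta2 lam by apply: alpha_gt0.
have tt0 lam : 0 < lam -> 0 < tanh (beta1 * lam) * tanh (beta2 * lam).
  by move=> l0; rewrite mulr_gt0// tanh_gt0// mulr_gt0//; lra.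
have f0 : 0 < f 0.
  have al0 b : alpha b 0 = b by rewrite /alpha /cosh mul0r oppr0 expR0; field.
  have th0 : tanh 0 = 0 :> R by rewrite /tanh /sinh oppr0 subrr !mul0r.
  rewrite /f !mulr0 th0 mulr0 subr0 !al0.
  by rewrite mulr_gt0//; lra.
have fL : f L < 0.
  have := tt0 _ L0; have := a2 L; rewrite /f; nra.
have [| |lam] := @IVT R f 0 L 0 (ltW L0).
- exact: continuous_subspaceT.
- by rewrite ge_min le_max (ltW f0) (ltW fL) orbT.
rewrite in_itv/= => /andP[lam0 _] flam; exists lam.
have {}lam0 : 0 < lam.
  by rewrite lt_def lam0 andbT; apply: contra_eq_neq flam => ->; rewrite gt_eqF.
move: flam; rewrite /f => /subr0_eq flam.
split => //; have := tt0 lam lam0; have := a2 lam; rewrite -flam; nra.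
Qed.

End modes.

(** * Turing instability *)

(** If x <= y, replacing y by x in the upper bound of p only increases it, and
    c |-> (a1 c - 1) (1 - a2 c) is increasing on [0, 1] because a1 + a2 < 2, so
    that p < (a1 - 1) (1 - a2). *)
Lemma det_sign_change (R : realFieldType) (a1 a2 x y p : R) :
  0 < a1 -> 0 < a2 -> a1 + a2 < 2 -> 0 < x < 1 -> 0 < y -> 0 < p ->
  (a1 - 1) * (1 - a2) < p -> p < (a1 * x - 1) * (1 - a2 * y) -> 1 < a1 * x ->
  [/\ a2 < 1, 1 < a1 & y < x].
Proof.
move=> a10 a20 a12 /andP[x0 x1] y0 p0 lep ltp a1x.
have a11 : 1 < a1 by nra.
have a21 : a2 < 1 by lra.
split=> //; rewrite ltNge; apply/negP => xy.
have : (a1 * x - 1) * (1 - a2 * y) <= (a1 * x - 1) * (1 - a2 * x).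
  by rewrite ler_pM2l ?subr_gt0// lerB// ler_pM2l.
suff : (a1 * x - 1) * (1 - a2 * x) <= (a1 - 1) * (1 - a2) by lra.
rewrite -subr_ge0.
have -> : (a1 - 1) * (1 - a2) - (a1 * x - 1) * (1 - a2 * x) =
  (1 - x) * (a1 + a2 - a1 * a2 - a1 * a2 * x) by ring.
have q : a1 * a2 <= 1 by nra.
have q2 : a1 * a2 * 2 <= a1 + a2 by nra.
have q0 : 0 < a1 * a2 by rewrite mulr_gt0.
by rewrite mulr_ge0//; nra.
Qed.

Lemma Turing_instability_dichotomy (R : realType)
    (beta1 beta2 tau1 tau2 lam : R) :
  0 < beta1 -> 0 < beta2 -> 0 < tau1 -> 0 < tau2 -> 0 < lam ->
  Turing_instability beta1 beta2 tau1 tau2 lam ->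
  (alpha beta2 lam < 1 /\ 1 < alpha beta1 lam /\ tau1 < tau2) \/
  (alpha beta1 lam < 1 /\ 1 < alpha beta2 lam /\ tau2 < tau1).
Proof.
move=> b1 b2 t1 t2 l0 [/linearly_stableP[]//].
rewrite /mode_trace /mode_det !gaussian_coef0 !mulr1 => tr0 det0.
move=> [k k0 uk]; have := (linearly_unstableP _ _ _ _ _ _ t1 t2).1 uk.
rewrite /mode_trace /mode_det.
have p0 : 0 < tanh (beta1 * lam) * tanh (beta2 * lam).
  by rewrite mulr_gt0// tanh_gt0// mulr_gt0.
have a1 := alpha_gt0 _ lam b1; have a2 := alpha_gt0 _ lam b2.
have x0 := gaussian_coef_gt0 tau1 k; have y0 := gaussian_coef_gt0 tau2 k.
have x1 := gaussian_coef_lt1 _ _ t1 k0; have y1 := gaussian_coef_lt1 _ _ t2 k0.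
have lt_tau (t t' : R) : gaussian_coef t k < gaussian_coef t' k -> t' < t.
  by rewrite !ltNge; apply: contra; exact: le_gaussian_coef.
move: (tanh _ * _) p0 det0 => p p0 det0.
move: (alpha beta1 lam) (alpha beta2 lam) a1 a2 tr0 det0.
move=> a b a0 b0 tr0 det0.
move: x0 y0 x1 y1 (lt_tau tau1 tau2) (lt_tau tau2 tau1).
move: (gaussian_coef tau1 k) (gaussian_coef tau2 k).
move=> x y x0 y0 x1 y1 ltxy ltyx.
have ax : a * x < a by rewrite gtr_pMr.
have bY : b * y < b by rewrite gtr_pMr.
case=> [|detk]; first by lra.
have [ax1|ax1] := ltP 1 (a * x).
  have [b1' a1' yx] : [/\ b < 1, 1 < a & y < x].
    by apply: (@det_sign_change _ a b x y p); rewrite ?x0//; lra.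
  by left; split=> //; split=> //; exact: ltyx.
have [a1' b1' xy] : [/\ a < 1, 1 < b & x < y].
  have by1 : 1 < b * y by nra.
  by apply: (@det_sign_change _ b a y x p); rewrite ?y0//; lra.
by right; split=> //; split=> //; exact: ltxy.
Qed.

Lemma linearly_stable_mode0 (R : realType) (beta1 beta2 tau1 tau2 lam : R) :
  0 < tau1 -> 0 < tau2 -> alpha beta1 lam + alpha beta2 lam < 2 ->
  (alpha beta1 lam - 1) * (1 - alpha beta2 lam) <
    tanh (beta1 * lam) * tanh (beta2 * lam) ->
  linearly_stable beta1 beta2 tau1 tau2 lam 0.
Proof.
move=> t1 t2 a12 h; apply/linearly_stableP => //.
by rewrite /mode_trace /mode_det !gaussian_coef0 !mulr1; split; lra.
Qed.

Lemma exists_Turing_instability (R : realType) (beta1 beta2 : R) :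
  1 < beta1 -> 0 < beta2 < 1 -> beta1 + beta2 < 2 ->
  exists lam tau1 tau2 : R,
    0 < lam /\ 0 < tau1 /\ 0 < tau2 /\
    Turing_instability beta1 beta2 tau1 tau2 lam.
Proof.
move=> b1 b2 b12; have [lam [l0 a1 bal]] := exists_balanced_lam _ _ b1 b2.
have /andP[b20 b21] := b2.
have b10 : 0 < beta1 by lra.
have ab1 := alpha_le _ lam b10; have ab2 := alpha_le _ lam b20.
have a20 := alpha_gt0 _ lam b20.
set a := alpha beta1 lam in a1 ab1 bal *.
set b := alpha beta2 lam in ab2 a20 bal *.
(* For these x and y = 1 / 4, (a x - 1) (1 - b y) = (a - 1) (1 - b / 4)^2, and
   (1 - b / 4)^2 > 1 - b / 2. *)
have [|tau1 t1 q1] := exists_gaussian_coef1 ((1 + (a - 1) * (1 - b / 4)) / a).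
  by rewrite divr_gt0/= ?ltr_pdivrMr; nra.
have [|tau2 t2 q2] := exists_gaussian_coef1 (4^-1 : R); first by lra.
exists lam, tau1, tau2; do 3 split=> //; split.
  by apply: linearly_stable_mode0 => //; rewrite -/a -/b ?bal; nra.
exists 1 => //; apply/linearly_unstableP => //; right.
rewrite /mode_det -/a -/b q1 q2 bal (mulrC a) divfK; last by lra.
rewrite addrAC subrr add0r.
have -> : (a - 1) * (1 - b / 2) - (a - 1) * (1 - b / 4) * (1 - b / 4) =
    - ((a - 1) * (b / 4) ^+ 2) by field.
by rewrite oppr_lt0; apply: mulr_gt0; [lra|apply: exprn_gt0; lra].
Qed.

Lemma absz_sqr_ge4 (k : int) :
  k != 0 -> k != 1 -> k != -1 -> (4 <= `|k|%N ^ 2)%N.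
Proof.
by case: k => [[|[|n]]|[|n]] //= _ _ _; rewrite (@leq_exp2r 2 _ 2).
Qed.

Lemma exists_unimodular_Turing_instability (R : realType) (beta1 beta2 : R) :
  1 < beta1 -> 9 / 10 < beta2 -> beta2 < 1 -> beta1 + beta2 < 2 ->
  exists lam tau1 tau2 : R,
    0 < lam /\ 0 < tau1 /\ 0 < tau2 /\
    unimodular_Turing_instability beta1 beta2 tau1 tau2 lam.
Proof.
move=> b1 b29 b21 b12.
have b20 : 0 < beta2 by lra.
have [|lam [l0 a1 bal]] := exists_balanced_lam beta1 beta2 b1.
  by rewrite b20.
have b10 : 0 < beta1 by lra.
have ab1 := alpha_le _ lam b10; have ab2 := alpha_le _ lam b20.
have a20 := alpha_gt0 _ lam b20.
(* alpha_1 > 1 and beta1 < 11 / 10 keep cosh, hence alpha_2, close to 1. *)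
have a23 : 4 / 5 < alpha beta2 lam.
  have c12 : cosh (lam * beta2) <= cosh (lam * beta1).
    by apply: le_cosh; rewrite mulr_ge0 ?ler_pM2l ?ltW//; lra.
  have c1 := cosh_gt0 (lam * beta1); have c2 := cosh_gt0 (lam * beta2).
  move: a1; rewrite /alpha ltr_pdivlMr ?exprn_gt0// ltr_pdivlMr ?exprn_gt0//.
  have : cosh (lam * beta2) ^+ 2 <= cosh (lam * beta1) ^+ 2.
    by rewrite lerXn2r// nnegrE ltW.
  by lra.
set a := alpha beta1 lam in a1 ab1 bal *.
set b := alpha beta2 lam in ab2 a20 a23 bal *.
have e0 : 0 < 1 + (a - 1) / 4 by lra.
have [|tau1 t1 q1] := exists_gaussian_coef1 ((1 + (a - 1) / 4)^-1).
  by rewrite invr_gt0 e0 invf_lt1//; lra.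
have [|tau2 t2 q2] := exists_gaussian_coef1 (20^-1 : R); first by lra.
have det1 : mode_det beta1 beta2 tau1 tau2 lam 1 < 0.
  rewrite /mode_det -/a -/b q1 q2 bal.
  have -> : a / (1 + (a - 1) / 4) - 1 = (a - 1) * (3 / 4 / (1 + (a - 1) / 4)).
    by field; lra.
  rewrite -subr_gt0 sub0r opprB.
  have -> : (a - 1) * (3 / 4 / (1 + (a - 1) / 4)) * (1 - b / 20) -
      (a - 1) * (1 - b / 2) =
      (a - 1) / (1 + (a - 1) / 4) *
      (3 / 4 * (1 - b / 20) - (1 - b / 2) * (1 + (a - 1) / 4)).
    by field; lra.
  (* b > 4/5 and a < 11/10: the bracket exceeds 3/4 * 19/20 - 3/5 * 41/40. *)
  have : (1 - b / 2) * (1 + (a - 1) / 4) <= 3 / 5 * (1 + (a - 1) / 4).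
    by rewrite ler_wpM2r; lra.
  by move=> ?; apply: mulr_gt0; [apply: divr_gt0|]; lra.
exists lam, tau1, tau2; do 3 split=> //; split.
- by apply/linearly_unstableP => //; right.
- apply/linearly_unstableP => //; right.
  by rewrite /mode_det !gaussian_coefN.
move=> k k1 kN1; have [->|k0] := eqVneq k 0.
  by apply: linearly_stable_mode0 => //; rewrite -/a -/b ?bal; nra.
have k2 := absz_sqr_ge4 _ k0 k1 kN1.
apply/linearly_stableP => //.
have c1 : a * gaussian_coef tau1 k <= 1.
  rewrite gaussian_coefE q1 exprVn ler_pdivrMr ?exprn_gt0// mul1r.
  apply: (@le_trans _ _ ((1 + (a - 1) / 4) ^+ 4)); last first.
    by rewrite ler_weXn2l//; lra.
  (* Bernoulli: (1 + u)^4 >= 1 + 4 u, for u = (a - 1) / 4. *)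
  rewrite -subr_ge0 (_ : _ - a = ((a - 1) / 4) ^+ 2 *
      (6 + 4 * ((a - 1) / 4) + ((a - 1) / 4) ^+ 2)); last by field.
  by apply: mulr_ge0; [exact: sqr_ge0|apply: addr_ge0; [lra|exact: sqr_ge0]].
have c2 := gaussian_coef_le1 _ k t2.
have bc2 : b * gaussian_coef tau2 k < 1.
  by apply: le_lt_trans (_ : b < 1); [rewrite ler_piMr// ltW|lra].
rewrite /mode_trace /mode_det -/a -/b bal; split; first by lra.
rewrite subr_gt0; apply: (@le_lt_trans _ _ 0).
  by apply: mulr_le0_ge0; lra.
by apply: mulr_gt0; lra.
Qed.

Theorem theorem2p4 (R : realType) :
  (forall beta1 beta2 tau1 tau2 lam : R,
     0 < beta2 -> beta2 <= beta1 -> 0 < tau1 -> 0 < tau2 -> 0 < lam ->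
     Turing_instability beta1 beta2 tau1 tau2 lam ->
     (alpha beta2 lam < 1 /\ 1 < alpha beta1 lam /\ tau1 < tau2) \/
     (alpha beta1 lam < 1 /\ 1 < alpha beta2 lam /\ tau2 < tau1)) /\
  (forall beta1 beta2 : R,
     0 < beta2 -> beta2 <= beta1 ->
     1 < beta1 -> beta2 < 1 -> beta1 + beta2 < 2 ->
     exists lam tau1 tau2 : R,
       0 < lam /\ 0 < tau1 /\ 0 < tau2 /\
       Turing_instability beta1 beta2 tau1 tau2 lam) /\
  (exists delta : R, 0 < delta /\ delta < 1 /\
     forall beta1 beta2 : R,
       0 < beta2 -> beta2 <= beta1 ->
       1 < beta1 -> 1 - delta < beta2 -> beta2 < 1 -> beta1 + beta2 < 2 ->
       exists lam tau1 tau2 : R,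
         0 < lam /\ 0 < tau1 /\ 0 < tau2 /\
         unimodular_Turing_instability beta1 beta2 tau1 tau2 lam).
Proof.
split; [|split].
- move=> beta1 beta2 tau1 tau2 lam b2 b12.
  by apply: Turing_instability_dichotomy => //; exact: lt_le_trans b12.
- move=> beta1 beta2 b20 _ b1 b21 b12.
  by apply: exists_Turing_instability => //; rewrite b20.
- exists 10^-1; do 2 (split; first by lra).
  move=> beta1 beta2 _ _ b1 b2 b21 b12.
  by apply: exists_unimodular_Turing_instability => //; lra.
Qed.
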